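(* Let $\epsilon\ge 0$, $\sigma,\gamma\ge 0$, $p\in[0,1]$ be constants, and let $H:\mathbb{R}^d\times\mathbb{R}\times\Omega\to\mathbb{R}$ be globally Lipschitz in its first two arguments (uniformly in the third) and nondecreasing in its second argument. Let $v\in C^5(\overline{\Omega})$, and for each mesh $\mathbf{h}$ let $V$ be the grid function with $V_\alpha=v(\mathbf{x}_\alpha)$ for $\mathbf{x}_\alpha\in\mathcal{T}_{\mathbf{h}}$, with values at the ghost points determined by the auxiliary boundary condition. Define the global truncation error $$E_{\mathbf{h}}(v)=\Big(\prod_{i=1}^d h_i^{1/2}\Big)\Big(\sum_{\mathbf{x}_\alpha\in\mathcal{T}_{\mathbf{h}}\cap\Omega}\big|H^\epsilon[v](\mathbf{x}_\alpha)-\widehat{H}^\epsilon_{\mathbf{h}}[V_\alpha]\big|^2\Big)^{1/2},$$ where $H^\epsilon[v](\mathbf{x})=-\epsilon\Delta v(\mathbf{x})+H(\nabla v(\mathbf{x}),v(\mathbf{x}),\mathbf{x})$ and $\widehat{H}^\epsilon_{\mathbf{h}}$ is the numerical operator defined in the context. Then: (1) if the auxiliary boundary condition is (BC1), the global truncation error has order $p+\tfrac12$, i.e. there is a constant $C$ independent of $\mathbf{h}$ with $E_{\mathbf{h}}(v)\le C h^{p+1/2}$; (2) if the auxiliary boundary condition is (BC2), the global truncation error has order $\min\{2,p+\tfrac32\}$, i.e. there is a constant $C$ independent of $\mathbf{h}$ with $E_{\mathbf{h}}(v)\le C h^{\min\{2,\,p+3/2\}}$.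
   Context: Domain and mesh: $\Omega=(a_1,b_1)\times\cdots\times(a_d,b_d)\subset\mathbb{R}^d$. For integers $J_i\ge 3$ set $h_i=(b_i-a_i)/(J_i-1)$, $\mathbf{h}=(h_1,\dots,h_d)$, $h=\max_i h_i$. The grid is $\mathcal{T}_{\mathbf{h}}=\{\mathbf{x}_\alpha\}$ with $\mathbf{x}_\alpha=(a_1+(\alpha_1-1)h_1,\dots,a_d+(\alpha_d-1)h_d)$, $1\le\alpha_i\le J_i$. Let $\mathbf{e}_i$ be the canonical basis vectors. Boundary nodes and ghost points: $\mathcal{S}_{h_i}$ is the set of $\mathbf{x}_\alpha\in\mathcal{T}_{\mathbf{h}}\cap\partial\Omega$ such that $\mathbf{x}_\alpha+h_i\mathbf{e}_i\in\mathcal{T}_{\mathbf{h}}\cap\Omega$ or $\mathbf{x}_\alpha-h_i\mathbf{e}_i\in\mathcal{T}_{\mathbf{h}}\cap\Omega$. For each $\mathbf{x}_\alpha\in\mathcal{S}_{h_i}$ the one of $\mathbf{x}_\alpha\pm h_i\mathbf{e}_i$ lying outside $\overline{\Omega}$ is a ghost point. Difference operators on grid functions $V$: $\delta_{x_i,h_i}V_\alpha=\frac{V_{\alpha+\mathbf{e}_i}-V_{\alpha-\mathbf{e}_i}}{2h_i}$, $\nabla_{\mathbf{h}}=[\delta_{x_1,h_1},\dots,\delta_{x_d,h_d}]^T$, $\delta^2_{x_i,h_i}V_\alpha=\frac{V_{\alpha+\mathbf{e}_i}-2V_\alpha+V_{\alpha-\mathbf{e}_i}}{h_i^2}$, $\delta^2_{x_i,2h_i}V_\alpha=\frac{V_{\alpha+2\mathbf{e}_i}-2V_\alpha+V_{\alpha-2\mathbf{e}_i}}{4h_i^2}$,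 $\Delta_{\mathbf{h}}=\sum_{i=1}^d\delta^2_{x_i,h_i}$. Numerical moment: $M^p_{\mathbf{h}}V_\alpha=\sum_{i=1}^d h_i^p\big(\delta^2_{x_i,2h_i}-\delta^2_{x_i,h_i}\big)V_\alpha$. Numerical operator, for $\mathbf{x}_\alpha\in\mathcal{T}_{\mathbf{h}}\cap\Omega$: $$\widehat{H}^\epsilon_{\mathbf{h}}[V_\alpha]=-\sigma\sum_{i=1}^d h_i^2\delta^2_{x_i,h_i}V_\alpha-\epsilon\Delta_{\mathbf{h}}V_\alpha+H(\nabla_{\mathbf{h}}V_\alpha,V_\alpha,\mathbf{x}_\alpha)+\gamma M^p_{\mathbf{h}}V_\alpha .$$ Auxiliary boundary conditions (these determine the ghost values needed to evaluate $\delta^2_{x_i,2h_i}$ at interior nodes adjacent to the boundary in direction $x_i$): (BC1) $\delta^2_{x_i,h_i}V_\alpha=0$ for all $\mathbf{x}_\alpha\in\mathcal{S}_{h_i}$, all $i$; (BC2) $\delta^2_{x_i,h_i}V_\alpha=\delta^2_{x_i,h_i}V_{\alpha'}$ for all $\mathbf{x}_\alpha\in\mathcal{S}_{h_i}$, all $i$, where $\mathbf{x}_{\alpha'}\in\{\mathbf{x}_\alpha-h_i\mathbf{e}_i,\mathbf{x}_\alpha+h_i\mathbf{e}_i\}$ is the neighbour lying in $\mathcal{T}_{\mathbf{h}}\cap\Omega$. Constants ''independent of $\mathbf{h}$'' may depend on $v,H,\Omega,d,\epsilon,\sigma,\gamma,p$. *)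

(* Defs.v *)
From HB Require Import structures.
From mathcomp Require Import all_boot all_order all_algebra.
From mathcomp Require Import all_classical all_reals all_analysis.

Set Implicit Arguments.
Unset Strict Implicit.
Unset Printing Implicit Defensive.

Import Order.TTheory GRing.Theory Num.Theory.
Import numFieldNormedType.Exports.

Local Open Scope classical_set_scope.
Local Open Scope ring_scope.

Section Smoothness.
Context {R : realType} {d : nat}.
Implicit Types (D : set 'rV[R]_d) (v : 'rV[R]_d -> R).

(* [pderiv [:: i1; ..; ik] v] is d_{i1} (d_{i2} (.. (d_{ik} v))). *)
Fixpoint pderiv (s : seq 'I_d) v : 'rV[R]_d -> R :=
  if s is i :: s' then fun x => 'D_(delta_mx 0 i) (pderiv s' v) x else v.

(* C^k(closure D) for an open D: all the iterated partial derivatives of order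
   at most k exist in D and extend continuously to the closure of D; at order 0
   the extension is v itself, whose values outside D matter on the boundary of
   D.  Values of v outside the closure of D are irrelevant. *)
Definition Ck_closure (k : nat) D v : Prop :=
  [/\ {within closure D, continuous v},
      forall (s : seq 'I_d) (i : 'I_d) x, (size s < k)%N -> D x ->
        derivable (pderiv s v) x (delta_mx 0 i)
    & forall s : seq 'I_d, (size s <= k)%N ->
        exists g : 'rV[R]_d -> R, {within closure D, continuous g} /\
          forall x, D x -> g x = pderiv s v x].

Definition grad v (x : 'rV[R]_d) : 'rV[R]_d := \row_i pderiv [:: i] v x.

Definition laplacian v (x : 'rV[R]_d) : R := \sum_(i < d) pderiv [:: i; i] v x.

End Smoothness.

Section Mesh.
Context {R : realType} {d : nat}.
Implicit Types (a b : 'rV[R]_d) (J : 'I_d -> nat) (alpha : 'rV[int]_d).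

Definition box a b : set 'rV[R]_d :=
  [set x | forall i, a 0 i < x 0 i < b 0 i].

Definition step a b J (i : 'I_d) : R := (b 0 i - a 0 i) / ((J i)%:R - 1).

Definition mesh_size a b J : R := \big[Num.max/0]_(i < d) step a b J i.

(* Multi-indices are integer vectors, so that indices shifted outside the grid
   (in particular those of ghost points) make sense. *)
Definition node a b J alpha : 'rV[R]_d :=
  \row_i (a 0 i + ((alpha 0 i)%:~R - 1) * step a b J i).

Definition in_grid J alpha : Prop := forall i, (1 <= alpha 0 i <= (J i)%:Z)%R.

Definition interior_idx a b J : set 'rV[int]_d :=
  [set alpha | in_grid J alpha /\ box a b (node a b J alpha)].

(* The box is open, so its boundary is its closure minus itself. *)
Definition boundary_idx a b J : set 'rV[int]_d :=
  [set alpha | in_grid J alpha /\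
    (closure (box a b) `\` box a b) (node a b J alpha)].

Definition eidx (i : 'I_d) : 'rV[int]_d := delta_mx 0 i.

(* The set S_{h_i} of boundary nodes having an interior neighbour in the
   direction e_i. *)
Definition bdry_nodes a b J (i : 'I_d) : set 'rV[int]_d :=
  [set alpha | boundary_idx a b J alpha /\
    (interior_idx a b J (alpha + eidx i) \/
     interior_idx a b J (alpha - eidx i))].

End Mesh.

(* Grid functions are functions of the multi-index; [h] is the vector of mesh
   steps. *)
Section DifferenceOperators.
Context {R : realType} {d : nat}.
Implicit Types (h : 'I_d -> R) (V : 'rV[int]_d -> R) (alpha : 'rV[int]_d).

Definition delta1 h (i : 'I_d) V alpha : R :=
  (V (alpha + eidx i) - V (alpha - eidx i)) / (2 * h i).

Definition grad_h h V alpha : 'rV[R]_d := \row_i delta1 h i V alpha.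

Definition delta2 h (i : 'I_d) V alpha : R :=
  (V (alpha + eidx i) - 2 * V alpha + V (alpha - eidx i)) / h i ^+ 2.

Definition delta2_2h h (i : 'I_d) V alpha : R :=
  (V (alpha + eidx i *+ 2) - 2 * V alpha + V (alpha - eidx i *+ 2))
    / (4 * h i ^+ 2).

Definition laplacian_h h V alpha : R := \sum_(i < d) delta2 h i V alpha.

Definition moment h (p : R) V alpha : R :=
  \sum_(i < d) (h i) `^ p * (delta2_2h h i V alpha - delta2 h i V alpha).

End DifferenceOperators.

Section Problem.
Context {R : realType} {d : nat}.
Implicit Types (a b : 'rV[R]_d) (J : 'I_d -> nat) (V : 'rV[int]_d -> R).
Implicit Types (H : 'rV[R]_d -> R -> 'rV[R]_d -> R) (v : 'rV[R]_d -> R).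

Definition Hop (eps : R) H v (x : 'rV[R]_d) : R :=
  - (eps * laplacian v x) + H (grad v x) (v x) x.

Definition Hop_h a b J (eps sigma gamma p : R) H V (alpha : 'rV[int]_d) : R :=
  let h := step a b J in
  - (sigma * \sum_(i < d) h i ^+ 2 * delta2 h i V alpha)
  - eps * laplacian_h h V alpha
  + H (grad_h h V alpha) (V alpha) (node a b J alpha)
  + gamma * moment h p V alpha.

(* Each equation of BC1 and BC2 is linear in the single ghost value adjacent to
   alpha in the direction e_i, and hence determines it from the grid values. *)
Definition BC1 a b J V : Prop :=
  forall i alpha, bdry_nodes a b J i alpha ->
    delta2 (step a b J) i V alpha = 0.

Definition BC2 a b J V : Prop :=
  forall i alpha alpha', bdry_nodes a b J i alpha ->
    alpha' = alpha - eidx i \/ alpha' = alpha + eidx i ->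
    interior_idx a b J alpha' ->
    delta2 (step a b J) i V alpha = delta2 (step a b J) i V alpha'.

Definition agrees_on_grid a b J v V : Prop :=
  forall alpha, in_grid J alpha -> V alpha = v (node a b J alpha).

(* The index set is finite, so [\sum_(_ \in _)] is the plain sum over it. *)
Definition truncation_error a b J (eps sigma gamma p : R) H v V : R :=
  (\prod_(i < d) Num.sqrt (step a b J i)) *
  Num.sqrt (\sum_(alpha \in interior_idx a b J)
    `|Hop eps H v (node a b J alpha)
      - Hop_h a b J eps sigma gamma p H V alpha| ^+ 2).

(* Joint Lipschitz continuity in the first two arguments, on the whole of
   R^d x R (with the sup norm), with a constant uniform in x. *)
Definition lipschitz12 (D : set 'rV[R]_d) H : Prop :=
  exists L : R, forall x, D x ->
    L.-lipschitz (fun z : 'rV[R]_d * R => H z.1 z.2 x).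

Definition nondecreasing2 (D : set 'rV[R]_d) H : Prop :=
  forall q x, D x -> {homo (fun u => H q u x) : u w / u <= w}.

End Problem.

(* Main.v *)
(** Since delta2_2h = (delta2 (. + e_i) + 2 delta2 + delta2 (. - e_i)) / 4, the
    moment in direction i is h_i^p / 4 times the undivided second difference of
    delta2.  At nodes whose two neighbours in direction i are interior this is
    O(h_i^(p+2)), and all the other terms of the residual are O(h^2) by Taylor
    expansion.  At the remaining nodes it is only O(h_i^(p+q)) with q = 0 for
    BC1 and q = 1 for BC2; but these nodes make up a fraction O(h_i) of the
    grid, whence a contribution O(h^(p+q+1/2)) to the discrete L^2 norm. *)

Require Import Defs.
From mathcomp Require Import all_boot all_order all_algebra.
From mathcomp Require Import all_classical all_reals all_analysis.
From mathcomp Require Import ring lra zify.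
Import Order.TTheory GRing.Theory Num.Theory.
Import numFieldNormedType.Exports.
Local Open Scope classical_set_scope.
Local Open Scope ring_scope.

(* The factor 1 / n.+1`! in the remainder is dropped. *)
Lemma taylor_right {R : realType} (n : nat) (F : nat -> R -> R) (M x y : R) :
  x < y -> {within `[x, y], continuous (F 0%N)} ->
  (forall k (z : R), (k <= n)%N -> x <= z < y ->
    is_derive z 1 (F k) (F k.+1 z)) ->
  (forall z : R, x <= z < y -> `|F n.+1 z| <= M) ->
  `|F 0%N y - \sum_(k < n.+1) F k x / k`!%:R * (y - x) ^+ k|
    <= M * (y - x) ^+ n.+1.
Proof.
elim: n => [|n IHn] in F y * => xy cF dF bF.
  have [c cxy ->] : exists2 c, c \in `]x, y[ &
      F 0%N y - \sum_(k < 1) F k x / k`!%:R * (y - x) ^+ k = F 1%N c * (y - x).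
    have [|c cxy E] := @MVT _ (F 0%N) (F 1%N) _ _ xy _ cF.
      by move=> z /[!in_itv]/= /andP[xz zy]; apply: dF; rewrite // ltW.
    exists c => //; rewrite -E big_ord1 /= fact0 expr0 divr1 mulr1 //.
  rewrite normrM expr1 (@ger0_norm _ (y - x)) ?subr_ge0 ?(ltW xy)//.
  rewrite ler_wpM2r ?subr_ge0 ?(ltW xy)// bF//.
  by move: cxy; rewrite in_itv/= => /andP[/ltW -> ->].
pose P z := \sum_(k < n.+2) F k x / k`!%:R * (z - x) ^+ k.
pose dP z := \sum_(k < n.+1) F k.+1 x / k`!%:R * (z - x) ^+ k.
have P_derive (z : R) : is_derive z 1 P (dP z).
  have dterm (i : 'I_n.+2) :
      is_derive z 1 (fun z => F i x / i`!%:R * (z - x) ^+ i)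
      (F i x / i`!%:R * (i%:R * (z - x) ^+ i.-1)).
    have dX := @is_deriveX _ _ (fun z => z - x) i z 1 1 (is_derive_shift _ _ _).
    have := is_deriveZ (F i x / i`!%:R) dX.
    rewrite exprfctE /GRing.scale/= mulr1; exact.
  have -> : P = \sum_(i < n.+2) (fun z => F i x / i`!%:R * (z - x) ^+ i).
    by apply/funext => t; rewrite fct_sumE.
  suff -> : dP z = \sum_(i < n.+2) F i x / i`!%:R * (i%:R * (z - x) ^+ i.-1).
    exact: is_derive_sum dterm.
  rewrite /dP [RHS]big_ord_recl/= mul0r mulr0 add0r; apply: eq_bigr => i _.
  rewrite /bump/= add1n factS natrM; field.
  by rewrite pnatr_eq0 -lt0n fact_gt0 /= nat1r pnatr_eq0.
have [||c cxy E] :=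
  @MVT _ (fun z => F 0%N z - P z) (fun z => F 1%N z - dP z) _ _ xy.
- move=> z /[!in_itv]/= /andP[xz zy]; apply: is_deriveB.
  by apply: dF; rewrite // ltW.
- apply: within_continuousB => //; apply: derivable_within_continuous => z _.
  exact: (@ex_derive _ _ _ _ _ _ _ (P_derive z)).
have Px : P x = F 0%N x.
  rewrite /P big_ord_recl big1 /= ?fact0 ?divr1 ?expr0 ?mulr1 ?addr0// => i _.
  by rewrite subrr exprS mul0r mulr0.
move: cxy; rewrite in_itv/= => /andP[xc cy].
rewrite Px subrr subr0 in E; rewrite -/(P y) E normrM exprSr mulrA.
rewrite (@ger0_norm _ (y - x)) ?subr_ge0 ?(ltW xy)//.
rewrite ler_wpM2r ?subr_ge0 ?(ltW xy)//.
apply: (@le_trans _ _ (M * (c - x) ^+ n.+1)).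
  apply: (IHn (F \o S) c) => //.
  - apply: derivable_within_continuous => z /[!in_itv]/= /andP[xz zc].
    by apply: ex_derive; apply: dF => //; rewrite xz (le_lt_trans zc).
  - by move=> k z kn /andP[xz zc]; apply: dF; rewrite // xz (lt_trans zc).
  - by move=> z /andP[xz zc]; apply: bF; rewrite xz (lt_trans zc).
have M0 : 0 <= M by apply: le_trans (bF x _); rewrite ?normr_ge0// lexx.
by rewrite ler_wpM2l// lerXn2r ?nnegrE ?subr_ge0 ?lerB// ltW.
Qed.

(* The terms with s + k odd cancel, which gives the centred differences their
   extra order of accuracy. *)
Lemma taylor_symmetric {R : realType} (s n : nat) (F : nat -> R -> R)
    (M T : R) :
  0 < T -> {within `[- T, T], continuous (F 0%N)} ->
  (forall k (z : R), (k <= n)%N -> - T < z < T ->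
    is_derive z 1 (F k) (F k.+1 z)) ->
  (forall z : R, - T < z < T -> `|F n.+1 z| <= M) ->
  `|F 0%N T + (-1) ^+ s * F 0%N (- T)
    - \sum_(k < n.+1) (1 + (-1) ^+ (s + k)) * F k 0 / k`!%:R * T ^+ k|
    <= 2 * M * T ^+ n.+1.
Proof.
move=> T0 cF dF bF.
pose G k (z : R) := F k z + (-1) ^+ (s + k) * F k (- z).
have -> : \sum_(k < n.+1) (1 + (-1) ^+ (s + k)) * F k 0 / k`!%:R * T ^+ k
    = \sum_(k < n.+1) G k 0 / k`!%:R * T ^+ k.
  by apply: eq_bigr => k _; rewrite /G oppr0 mulrDl mul1r.
have -> : F 0%N T + (-1) ^+ s * F 0%N (- T) = G 0%N T by rewrite /G addn0.
have sub (z : R) : 0 <= z < T -> (- T < z < T) /\ (- T < - z < T).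
  by move=> /andP[? ?]; split; apply/andP; split; lra.
have := @taylor_right _ n G (2 * M) 0 T T0; rewrite subr0; apply.
- have c1 : {within `[0, T], continuous (F 0%N)}.
    apply: continuous_subspaceW cF => z /=; rewrite !in_itv/= => /andP[z0 ->].
    by rewrite andbT (le_trans _ z0)// oppr_le0 ltW.
  apply: within_continuousD => //.
  have c2 : {within `[0, T], continuous (F 0%N \o -%R)}.
    apply: within_continuous_compN.
    apply: continuous_subspaceW cF => z /=; rewrite !in_itv/= => /andP[-> z0]/=.
    by rewrite oppr0 in z0; rewrite (le_trans z0)// ltW.
  have := within_continuous_comp _ _ (fun u : R => (-1) ^+ (s + 0) * u) _ c2.
  by apply=> z _; exact: mulrl_continuous.
- move=> k z kn /sub[zT NzT].
  have d1 := dF k z kn zT; have d2 := dF k (- z) kn NzT.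
  have d3 : is_derive z 1 (fun z : R => F k (- z)) (- F k.+1 (- z)).
    by rewrite -mulrN1; apply: is_derive1_comp.
  have := is_deriveD d1 (is_deriveZ ((-1) ^+ (s + k)) d3).
  rewrite /G /GRing.scale/= mulrN -mulNr addnS exprS mulN1r; exact.
- move=> z /sub[zT NzT]; apply: le_trans (ler_normD _ _) _.
  by rewrite normrM normrX normrN1 expr1n mul1r mulr_natl lerD// bF.
Qed.

Lemma first_difference {R : realType} (F : nat -> R -> R) (M T : R) :
  0 < T -> {within `[- T, T], continuous (F 0%N)} ->
  (forall k (z : R), (k <= 2)%N -> - T < z < T ->
    is_derive z 1 (F k) (F k.+1 z)) ->
  (forall z : R, - T < z < T -> `|F 3%N z| <= M) ->
  `|(F 0%N T - F 0%N (- T)) / (2 * T) - F 1%N 0| <= M * T ^+ 2.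
Proof.
move=> T0 cF dF /(taylor_symmetric 1 2 F M T T0 cF dF).
rewrite !big_ord_recl big_ord0/= /bump/= !exprS !expr0.
rewrite ?addn0 ?add1n ?factS fact0 ?muln1 => h.
have -> : (F 0%N T - F 0%N (- T)) / (2 * T) - F 1%N 0 =
  (2 * T)^-1 * (F 0%N T - F 0%N (- T) - 2 * T * F 1%N 0) by field; lra.
rewrite normrM ger0_norm ?invr_ge0; last lra.
rewrite ler_pdivrMl; last lra.
apply: le_trans (le_trans h _); rewrite le_eqVlt; apply/orP; left; apply/eqP;
  last ring.
by congr `|_|; field.
Qed.

Lemma second_difference {R : realType} (F : nat -> R -> R) (M T : R) :
  0 < T -> {within `[- T, T], continuous (F 0%N)} ->
  (forall k (z : R), (k <= 3)%N -> - T < z < T ->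
    is_derive z 1 (F k) (F k.+1 z)) ->
  (forall z : R, - T < z < T -> `|F 4%N z| <= M) ->
  `|(F 0%N T - 2 * F 0%N 0 + F 0%N (- T)) / T ^+ 2 - F 2%N 0| <= 2 * M * T ^+ 2.
Proof.
move=> T0 cF dF /(taylor_symmetric 0 3 F M T T0 cF dF).
rewrite !big_ord_recl big_ord0/= /bump/= !exprS !expr0.
rewrite ?addn0 ?add1n ?factS fact0 ?muln1 => h.
have -> : (F 0%N T - 2 * F 0%N 0 + F 0%N (- T)) / (T * (T * 1)) - F 2%N 0 =
  (T * (T * 1))^-1
  * (F 0%N T - 2 * F 0%N 0 + F 0%N (- T) - T * (T * 1) * F 2%N 0)
  by field; lra.
have T20 : 0 < T * (T * 1) by rewrite mulr1 mulr_gt0.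
rewrite normrM (@ger0_norm _ _^-1) ?invr_ge0 ?(ltW T20)//.
rewrite ler_pdivrMl//.
apply: le_trans (le_trans h _); rewrite le_eqVlt; apply/orP; left; apply/eqP;
  last ring.
by congr `|_|; field.
Qed.

Lemma second_difference_bound {R : realType} (F : nat -> R -> R) (M T : R) :
  0 < T -> {within `[- T, T], continuous (F 0%N)} ->
  (forall k (z : R), (k <= 1)%N -> - T < z < T ->
    is_derive z 1 (F k) (F k.+1 z)) ->
  (forall z : R, - T < z < T -> `|F 2%N z| <= M) ->
  `|F 0%N T - 2 * F 0%N 0 + F 0%N (- T)| <= 2 * M * T ^+ 2.
Proof.
move=> T0 cF dF /(taylor_symmetric 0 1 F M T T0 cF dF).
rewrite !big_ord_recl big_ord0/= /bump/= !exprS !expr0.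
rewrite ?addn0 ?add1n ?factS fact0 ?muln1 => h.
apply: le_trans (le_trans h _); rewrite le_eqVlt; apply/orP; left; apply/eqP;
  last ring.
by congr `|_|; field.
Qed.

Lemma closed_box_compact {R : realType} {d : nat} (a b : 'rV[R]_d) :
  compact [set x : 'rV[R]_d | forall i, a 0 i <= x 0 i <= b 0 i].
Proof.
have := @rV_compact R d (fun i => `[a 0 i, b 0 i]%classic)
  (fun i => @segment_compact R (a 0 i) (b 0 i)).
by congr compact; apply/seteqP; split=> x /= h i; have := h i; rewrite in_itv.
Qed.

Lemma closure_box {R : realType} {d : nat} (a b : 'rV[R]_d) :
  (forall i, a 0 i < b 0 i) ->
  closure (box a b) = [set x | forall i, a 0 i <= x 0 i <= b 0 i].
Proof.
move=> ab; rewrite eqEsubset; split.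
  have cl : closed [set x : 'rV[R]_d | forall i, a 0 i <= x 0 i <= b 0 i].
    apply: compact_closed; first exact: norm_hausdorff.
    exact: closed_box_compact.
  rewrite [X in _ `<=` X](closure_id _).1//.
  by apply: closure_subset => x h i; have /andP[? ?] := h i; rewrite !ltW.
move=> x xab B Bx.
pose c : 'rV[R]_d := \row_i ((a 0 i + b 0 i) / 2).
pose f (t : R) : 'rV[R]_d := x + t *: (c - x).
have f0 : f t @[t --> 0^'+] --> x.
  apply: cvg_at_right_filter; rewrite -[X in _ --> X]addr0 -(scale0r (c - x)).
  by apply: cvgD; [exact: cvg_cst|apply: cvgZr_tmp; exact: cvg_id].
have [t [Bt /andP[t0 t1]]] : exists t, B (f t) /\ 0 < t < 1.
  have : \forall t \near 0^'+, B (f t) /\ 0 < t < 1.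
    near=> t; split; first by near: t; exact: f0.
    by apply/andP; split; near: t; [exact: nbhs_right_gt|exact: nbhs_right_lt].
  by move/filter_ex; apply; exact: at_right_proper_filter.
exists (f t); split=> // i; rewrite /f /c !mxE.
have := ab i; have /andP[ax xb] := xab i => abi.
by apply/andP; split; nra.
Unshelve. all: by end_near.
Qed.

Lemma within_continuous_line {R : realType} {d : nat} (A : set 'rV[R]_d)
    (v : 'rV[R]_d -> R) (x e : 'rV[R]_d) (T : R) :
  {within A, continuous v} -> (forall t : R, - T <= t <= T -> A (x + t *: e)) ->
  {within `[- T, T], continuous (fun t => v (x + t *: e))}.
Proof.
move=> /subspace_continuousP cv TA; apply/subspace_continuousP => t Tt.
have At s : s \in `[- T, T] -> A (x + s *: e).
  by rewrite in_itv/= => h; apply: TA.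
apply: (cvg_comp _ v _ (cv _ (At _ Tt))) => B /= nB.
have ct : x + s *: e @[s --> t] --> x + t *: e.
  by apply: cvgD; [exact: cvg_cst|apply: cvgZr_tmp; exact: cvg_id].
change (nbhs t [set s | s \in `[- T, T] -> B (x + s *: e)]).
apply: (@filterS _ (nbhs t) _ [set s | A (x + s *: e) -> B (x + s *: e)]).
  by move=> s h Ts; apply: h; exact: At.
exact: ct _ nB.
Qed.

Lemma is_derive_line {R : realType} {d : nat} (f : 'rV[R]_d -> R)
    (x e : 'rV[R]_d) (t : R) :
  derivable f (x + t *: e) e ->
  is_derive t 1 (fun t => f (x + t *: e)) ('D_e f (x + t *: e)).
Proof.
have E : (fun h : R => h^-1 *: (((fun t => f (x + t *: e)) \o shift t) (h *: 1)
    - f (x + t *: e))) =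
    (fun h => h^-1 *: ((f \o shift (x + t *: e)) (h *: e) - f (x + t *: e))).
  apply/funext => h /=; congr (_ *: (f _ - _)).
  by rewrite [h *: 1]mulr1 scalerDl addrCA.
by move=> df; split; rewrite /derivable /derive E.
Qed.

Lemma pure_pderiv_bounded {R : realType} {d : nat} (a b : 'rV[R]_d) (k : nat)
    (v : 'rV[R]_d -> R) :
  (forall i, a 0 i < b 0 i) -> Ck_closure k (box a b) v ->
  exists M, 0 <= M /\ forall i j x, (j <= k)%N -> box a b x ->
    `|pderiv (nseq j i) v x| <= M.
Proof.
move=> ab [_ _ ext].
have cpt : compact (closure (box a b)).
  by rewrite closure_box//; exact: closed_box_compact.
have bnd (ij : 'I_d * 'I_k.+1) : exists M, 0 <= M /\ forall x, box a b x ->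
    `|pderiv (nseq ij.2 ij.1) v x| <= M.
  have [|g [cg gE]] := ext (nseq ij.2 ij.1); first by rewrite size_nseq -ltnS.
  have [M0 [_ hM]] := compact_bounded (continuous_compact cg cpt).
  have M1 : M0 < `|M0| + 1 by rewrite (le_lt_trans (ler_norm _))// ltrDl.
  exists (`|M0| + 1); split=> [|x Dx]; first by rewrite addr_ge0.
  by rewrite -gE//; apply: hM M1 _ _; exists x => //; exact: subset_closure.
have [M hM] := choice bnd.
have M0 ij : 0 <= M ij by case: (hM ij).
exists (\sum_ij M ij); split=> [|i j x jk Dx]; first exact: sumr_ge0.
have jk' : (j < k.+1)%N by rewrite ltnS.
have [_ /(_ _ Dx) /le_trans] := hM (i, Ordinal jk'); apply.
by rewrite (bigD1 (i, Ordinal jk'))//= lerDl sumr_ge0.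
Qed.

Lemma norm_sum_le {R : realType} {d : nat} (f : 'I_d -> R) (B : R) :
  (forall i, `|f i| <= B) -> `|\sum_(i < d) f i| <= d%:R * B.
Proof.
move=> fB; apply: le_trans (ler_norm_sum _ _ _) _.
apply: le_trans (ler_sum _ (fun i _ => fB i)) _.
by rewrite sumr_const card_ord mulr_natl.
Qed.

(* The interior indices with a boundary neighbour are 2 and J i - 1. *)
Definition near_bdry {d : nat} (J : 'I_d -> nat) (i : 'I_d) (k : int) : bool :=
  (k == 2) || (k == (J i)%:Z - 1).

Section TruncationError.
Context {R : realType} {d : nat} (a b : 'rV[R]_d).
Context (ab : forall i, a 0 i < b 0 i).
Context (v : 'rV[R]_d -> R) (v_C5 : Ck_closure 5 (box a b) v) (M : R).
Context (Mv : forall i j x, (j <= 5)%N -> box a b x ->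
  `|pderiv (nseq j i) v x| <= M).

Local Notation e i := (delta_mx 0 i : 'rV[R]_d).

Lemma box_segment x i T t : box a b x -> closure (box a b) (x + T *: e i) ->
  closure (box a b) (x - T *: e i) -> - T < t < T -> box a b (x + t *: e i).
Proof.
rewrite closure_box// => xab xT xNT /andP[tT1 tT2] j.
have := xab j; have := xT j; have := xNT j.
rewrite !mxE; case: (j == i) => /=; rewrite ?mulr1 ?mulr0 ?subr0 ?addr0//.
by move=> /andP[? ?] /andP[? ?] /andP[? ?]; apply/andP; split; lra.
Qed.

Lemma closure_box_segment x i T t : box a b x ->
  closure (box a b) (x + T *: e i) -> closure (box a b) (x - T *: e i) ->
  - T <= t <= T -> closure (box a b) (x + t *: e i).
Proof.
rewrite closure_box// => xab xT xNT /andP[tT1 tT2] j.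
have := xab j; have := xT j; have := xNT j.
rewrite !mxE; case: (j == i) => /=; rewrite ?mulr1 ?mulr0 ?subr0 ?addr0//.
by move=> /andP[? ?] /andP[? ?] /andP[? ?]; apply/andP; split; lra.
Qed.

Lemma is_derive_pure_pderiv x i k t : (k < 5)%N -> box a b (x + t *: e i) ->
  is_derive t 1 (fun t => pderiv (nseq k i) v (x + t *: e i))
    (pderiv (nseq k.+1 i) v (x + t *: e i)).
Proof.
move=> k5 Dx; apply: is_derive_line; case: v_C5 => _ dv _.
by apply: dv; rewrite ?size_nseq.
Qed.

Section Symmetric.
Context (x : 'rV[R]_d) (i : 'I_d) (T : R).
Context (T0 : 0 < T) (xD : box a b x).
Context (xT : closure (box a b) (x + T *: e i)).
Context (xNT : closure (box a b) (x - T *: e i)).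

Let F k t := pderiv (nseq k i) v (x + t *: e i).

Let F_derive k t : (k < 5)%N -> - T < t < T -> is_derive t 1 (F k) (F k.+1 t).
Proof.
by move=> k5 tT; apply: is_derive_pure_pderiv => //; exact: box_segment tT.
Qed.

Let F_bound k t : (k <= 5)%N -> - T < t < T -> `|F k t| <= M.
Proof. by move=> k5 tT; apply: Mv => //; exact: box_segment tT. Qed.

Let F_continuous : {within `[- T, T], continuous (F 0%N)}.
Proof.
apply: within_continuous_line => [|t tT]; first by case: v_C5.
exact: closure_box_segment tT.
Qed.

Lemma first_difference_error :
  `|(v (x + T *: e i) - v (x - T *: e i)) / (2 * T) - pderiv [:: i] v x|
    <= M * T ^+ 2.
Proof.
have := first_difference F M T T0 F_continuous.
rewrite /F/= scaleNr scale0r addr0; apply=> [k z k2|z] zT.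
  by apply: F_derive => //; apply: leq_trans k2 _.
exact: (F_bound 3%N).
Qed.

Lemma second_difference_error :
  `|(v (x + T *: e i) - 2 * v x + v (x - T *: e i)) / T ^+ 2
    - pderiv [:: i; i] v x| <= 2 * M * T ^+ 2.
Proof.
have := second_difference F M T T0 F_continuous.
rewrite /F/= scaleNr scale0r addr0; apply=> [k z k2|z] zT.
  by apply: F_derive => //; apply: leq_trans k2 _.
exact: (F_bound 4%N).
Qed.

Lemma second_difference_le :
  `|(v (x + T *: e i) - 2 * v x + v (x - T *: e i)) / T ^+ 2| <= 2 * M.
Proof.
have T20 : 0 < T ^+ 2 by rewrite exprn_gt0.
rewrite normrM (@ger0_norm _ (_ ^-1)) ?invr_ge0 ?(ltW T20)// ler_pdivrMr//.
have := second_difference_bound F M T T0 F_continuous.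
rewrite /F/= scaleNr scale0r addr0; apply=> [k z k2|z] zT.
  by apply: F_derive => //; apply: leq_trans k2 _.
exact: (F_bound 2%N).
Qed.

End Symmetric.

Lemma box_convex x i T t : box a b x -> box a b (x + T *: e i) ->
  0 <= t <= T -> box a b (x + t *: e i).
Proof.
move=> xab xT /andP[t0 tT] j; have := xab j; have := xT j.
rewrite !mxE; case: (j == i) => /=; rewrite ?mulr1 ?mulr0 ?subr0 ?addr0//.
by move=> /andP[? ?] /andP[? ?]; apply/andP; split; lra.
Qed.

Lemma pderiv2_increment x i T : 0 < T -> box a b x -> box a b (x + T *: e i) ->
  `|pderiv [:: i; i] v (x + T *: e i) - pderiv [:: i; i] v x| <= M * T.
Proof.
move=> T0 xD xT.
pose F k (t : R) := pderiv (nseq k.+2 i) v (x + t *: e i).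
have seg (t : R) : 0 <= t <= T -> box a b (x + t *: e i).
  exact: box_convex.
have := taylor_right 0 F M 0 T T0.
rewrite big_ord1 /F/= scale0r addr0 subr0 fact0 divr1 expr0 mulr1 expr1.
apply=> [|k z|z].
- apply: derivable_within_continuous => z; rewrite in_itv/= => zT.
  by apply: ex_derive; apply: (is_derive_pure_pderiv x i 2%N) => //; exact: seg.
- rewrite leqn0 => /eqP -> /andP[z0 /ltW zT].
  by apply: (is_derive_pure_pderiv x i 2%N) => //; apply: seg; rewrite z0.
- by move=> /andP[z0 /ltW zT]; apply: (Mv _ 3%N) => //; apply: seg; rewrite z0.
Qed.

Lemma pderiv2_second_difference x i T : 0 < T -> box a b x ->
  box a b (x + T *: e i) -> box a b (x - T *: e i) ->
  `|pderiv [:: i; i] v (x + T *: e i) - 2 * pderiv [:: i; i] v x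
    + pderiv [:: i; i] v (x - T *: e i)| <= 2 * M * T ^+ 2.
Proof.
move=> T0 xD xT xNT.
pose F k (t : R) := pderiv (nseq k.+2 i) v (x + t *: e i).
have seg (t : R) : - T <= t <= T -> box a b (x + t *: e i).
  move=> /andP[tT1 tT2] j; have := xD j; have := xT j; have := xNT j.
  rewrite !mxE; case: (j == i) => /=; rewrite ?mulr1 ?mulr0 ?subr0 ?addr0//.
  by move=> /andP[? ?] /andP[? ?] /andP[? ?]; apply/andP; split; lra.
have := second_difference_bound F M T T0.
rewrite /F/= scaleNr scale0r addr0; apply=> [|k z k1|z] /=.
- apply: derivable_within_continuous => z; rewrite in_itv/= => zT.
  by apply: ex_derive; apply: (is_derive_pure_pderiv x i 2%N) => //; exact: seg.
- move=> /andP[/ltW z0 /ltW zT].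
  apply: (is_derive_pure_pderiv x i k.+2); last by apply: seg; rewrite z0.
  by rewrite !ltnS (leq_trans k1).
- move=> /andP[/ltW z0 /ltW zT].
  by apply: (Mv _ 4%N) => //; apply: seg; rewrite z0.
Qed.

Section Grid.
Context (J : 'I_d -> nat) (J3 : forall i, (3 <= J i)%N).

Local Notation h := (step a b J).
Local Notation x_ := (node a b J).

Lemma step_gt0 i : 0 < h i.
Proof.
by rewrite /step divr_gt0 ?subr_gt0 ?ab// ltr1n (leq_trans _ (J3 i)).
Qed.

Lemma step_mul i : h i * ((J i)%:R - 1) = b 0 i - a 0 i.
Proof.
rewrite /step divfK// subr_eq0 pnatr_eq1.
by apply/eqP => Ji; have := J3 i; rewrite Ji.
Qed.

Lemma step_le_mesh_size i : h i <= mesh_size a b J.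
Proof. by rewrite /mesh_size; apply: le_bigmax. Qed.

Lemma step_le_width i : h i <= b 0 i - a 0 i.
Proof.
rewrite -step_mul ler_peMr ?(ltW (step_gt0 i))// lerBrDr.
by rewrite -(natrD _ 1 1) ler_nat (leq_trans _ (J3 i)).
Qed.

Lemma node_coord alpha i :
  (x_ alpha 0 i - a 0 i = ((alpha 0 i)%:~R - 1) * h i) *
  (b 0 i - x_ alpha 0 i = ((J i)%:R - (alpha 0 i)%:~R) * h i).
Proof.
rewrite /node mxE; split; first by rewrite addrC addKr.
by rewrite opprD addrA -step_mul; ring.
Qed.

Lemma node_in_box alpha i : (a 0 i < x_ alpha 0 i < b 0 i) =
  (1 < alpha 0 i < (J i)%:Z).
Proof.
rewrite -(subr_gt0 (a 0 i)) -(subr_gt0 (x_ alpha 0 i)) !(node_coord alpha i).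
rewrite !(@pmulr_lgt0 _ (h i)) ?step_gt0//.
by rewrite !subr_gt0 -(ltr_int R 1) -(ltr_int R (alpha 0 i)).
Qed.

Lemma node_in_closed_box alpha i : (a 0 i <= x_ alpha 0 i <= b 0 i) =
  (1 <= alpha 0 i <= (J i)%:Z).
Proof.
rewrite -(subr_ge0 (a 0 i)) -(subr_ge0 (x_ alpha 0 i)) !(node_coord alpha i).
rewrite !(@pmulr_lge0 _ (h i)) ?step_gt0//.
by rewrite !subr_ge0 -(ler_int R 1) -(ler_int R (alpha 0 i)).
Qed.

Lemma interior_idxP alpha :
  interior_idx a b J alpha <-> forall i, 1 < alpha 0 i < (J i)%:Z.
Proof.
split=> [[_ xD] i|aD]; first by rewrite -node_in_box.
split=> i; last by rewrite node_in_box.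
by have /andP[? ?] := aD i; rewrite !ltW.
Qed.

Lemma closure_box_grid alpha : in_grid J alpha -> closure (box a b) (x_ alpha).
Proof.
by move=> aJ; rewrite closure_box// => i; rewrite node_in_closed_box.
Qed.

Lemma node_shift alpha i :
  (x_ (alpha + eidx i) = x_ alpha + h i *: e i) *
  (x_ (alpha - eidx i) = x_ alpha - h i *: e i).
Proof.
by split; apply/rowP => j; rewrite /eidx !mxE /=; case: eqVneq => [->|_] /=;
  rewrite ?rmorphD ?rmorphN ?rmorph1 ?rmorph0/= ?mulr1 ?mulr0; ring.
Qed.

Lemma interior_neighbor_in_grid alpha i : interior_idx a b J alpha ->
  in_grid J (alpha + eidx i) * in_grid J (alpha - eidx i).
Proof.
move=> /interior_idxP aD; split=> j; have /andP[h1 h2] := aD j;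
  by rewrite /eidx !mxE /=; case: (j == i) => /=; lia.
Qed.

Lemma neighbor_bdry_nodes alpha alpha' i : interior_idx a b J alpha ->
  alpha' = alpha + eidx i \/ alpha' = alpha - eidx i ->
  ~ interior_idx a b J alpha' -> bdry_nodes a b J i alpha'.
Proof.
move=> aD aa' a'D.
have a'J : in_grid J alpha'.
  by have [? ?] := interior_neighbor_in_grid alpha i aD; case: aa' => ->.
split.
  split=> //; split; first exact: closure_box_grid.
  by move=> x'D; apply: a'D.
by case: aa' => ->; [right; rewrite addrK|left; rewrite subrK].
Qed.

Section GridFunction.
Context (V : 'rV[int]_d -> R) (agr : agrees_on_grid a b J v V).

Let V_interior alpha i : interior_idx a b J alpha ->
  [/\ V alpha = v (x_ alpha), V (alpha + eidx i) = v (x_ alpha + h i *: e i) &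
      V (alpha - eidx i) = v (x_ alpha - h i *: e i)].
Proof.
move=> aD; have [apJ amJ] := interior_neighbor_in_grid alpha i aD.
by case: (aD) => aJ _; rewrite !agr// !node_shift.
Qed.

Let closure_neighbor alpha i : interior_idx a b J alpha ->
  closure (box a b) (x_ alpha + h i *: e i) /\
  closure (box a b) (x_ alpha - h i *: e i).
Proof.
move=> aD; have [apJ amJ] := interior_neighbor_in_grid alpha i aD.
by rewrite -!node_shift; split; exact: closure_box_grid.
Qed.

Lemma delta1_error alpha i : interior_idx a b J alpha ->
  `|delta1 h i V alpha - pderiv [:: i] v (x_ alpha)| <= M * h i ^+ 2.
Proof.
move=> aD; rewrite /delta1; have [_ -> ->] := V_interior alpha i aD.
have [? ?] := closure_neighbor alpha i aD; have [_ ?] := aD.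
exact: first_difference_error (step_gt0 i) _ _ _.
Qed.

Lemma delta2_error alpha i : interior_idx a b J alpha ->
  `|delta2 h i V alpha - pderiv [:: i; i] v (x_ alpha)| <= 2 * M * h i ^+ 2.
Proof.
move=> aD; rewrite /delta2; have [-> -> ->] := V_interior alpha i aD.
have [? ?] := closure_neighbor alpha i aD; have [_ ?] := aD.
exact: second_difference_error (step_gt0 i) _ _ _.
Qed.

Lemma delta2_le alpha i : interior_idx a b J alpha ->
  `|delta2 h i V alpha| <= 2 * M.
Proof.
move=> aD; rewrite /delta2; have [-> -> ->] := V_interior alpha i aD.
have [? ?] := closure_neighbor alpha i aD; have [_ ?] := aD.
exact: second_difference_le (step_gt0 i) _ _ _.
Qed.

Lemma delta2_increment alpha i : interior_idx a b J alpha ->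
  interior_idx a b J (alpha + eidx i) ->
  `|delta2 h i V (alpha + eidx i) - delta2 h i V alpha|
    <= M * h i + 4 * M * h i ^+ 2.
Proof.
move=> aD apD.
have := delta2_error alpha i aD; have := delta2_error _ i apD.
case: (aD) (apD) => _ xD [_ xpD]; rewrite !node_shift in xpD *.
have := pderiv2_increment (x_ alpha) i (h i) (step_gt0 i) xD xpD.
move: (pderiv _ _ _) (pderiv _ _ _) => d1 d2.
move: (delta2 _ _ _ _) (delta2 _ _ _ _) (h i) => e1 e2 t.
rewrite !ler_norml => /andP[? ?] /andP[? ?] /andP[? ?].
by apply/andP; split; lra.
Qed.

Lemma moment_identity alpha i :
  delta2_2h h i V alpha - delta2 h i V alpha =
  (delta2 h i V (alpha + eidx i) - 2 * delta2 h i V alpha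
   + delta2 h i V (alpha - eidx i)) / 4.
Proof.
rewrite /delta2_2h /delta2 !mulr2n !opprD !addrA !addrK !subrK.
by have := step_gt0 i => /lt0r_neq0 h0; field.
Qed.

Context (M0 : 0 <= M).

Lemma moment_term_interior alpha i : interior_idx a b J alpha ->
  interior_idx a b J (alpha + eidx i) -> interior_idx a b J (alpha - eidx i) ->
  `|delta2_2h h i V alpha - delta2 h i V alpha| <= 3 * M * h i ^+ 2.
Proof.
move=> aD apD amD.
rewrite moment_identity normrM (@ger0_norm _ 4^-1) ?invr_ge0//.
rewrite ler_pdivrMr//.
have := delta2_error alpha i aD; have := delta2_error _ i apD.
have := delta2_error _ i amD.
case: (aD) (apD) (amD) => _ xD [_ xpD] [_ xmD].
rewrite !node_shift in xpD xmD *.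
have := pderiv2_second_difference (x_ alpha) i (h i) (step_gt0 i) xD xpD xmD.
have : 0 <= M * h i ^+ 2 by rewrite mulr_ge0// sqr_ge0.
move: (pderiv _ _ _) (pderiv _ _ _) (pderiv _ _ _) => d1 d2 d3.
move: (delta2 _ _ _ _) (delta2 _ _ _ _) (delta2 _ _ _ _) => e1 e2 e3.
rewrite -!(mulrA _ M (h i ^+ 2)); move: (M * h i ^+ 2) => t t0.
rewrite !ler_norml => /andP[? ?] /andP[? ?] /andP[? ?] /andP[? ?].
by apply/andP; split; lra.
Qed.

Context (K : R) (q : nat) (K0 : 0 <= K).
Context (incr : forall alpha alpha' i, interior_idx a b J alpha ->
  alpha' = alpha + eidx i \/ alpha' = alpha - eidx i ->
  `|delta2 h i V alpha' - delta2 h i V alpha| <= K * h i ^+ q).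

Lemma moment_term_le alpha i : interior_idx a b J alpha ->
  `|delta2_2h h i V alpha - delta2 h i V alpha|
    <= 3 * M * h i ^+ 2 + K * h i ^+ q * (near_bdry J i (alpha 0 i))%:R.
Proof.
move=> aD; have hi0 := ltW (step_gt0 i).
have [nb|nb] := boolP (near_bdry J i (alpha 0 i)).
  have B0 : 0 <= 3 * M * h i ^+ 2.
    by apply: mulr_ge0; [exact: mulr_ge0|exact: exprn_ge0].
  rewrite mulr1 -[X in X <= _]add0r lerD//.
  rewrite moment_identity normrM (@ger0_norm _ 4^-1) ?invr_ge0// ler_pdivrMr//.
  have := incr _ _ i aD (or_introl erefl).
  have := incr _ _ i aD (or_intror erefl).
  have : 0 <= K * h i ^+ q by rewrite mulr_ge0// exprn_ge0.
  move: (K * h i ^+ q) (delta2 _ _ _ _) (delta2 _ _ _ _) (delta2 _ _ _ _).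
  move=> t e1 e2 e3 t0; rewrite !ler_norml => /andP[? ?] /andP[? ?].
  by apply/andP; split; lra.
rewrite mulr0 addr0; move: nb; rewrite negb_or => /andP[/eqP n1 /eqP n2].
by apply: moment_term_interior => //; apply/interior_idxP => j;
  have /interior_idxP /(_ j) := aD; rewrite /eidx !mxE /=;
  case: eqVneq => [E|_] /=; rewrite ?{}E; lia.
Qed.

Context (W : R) (W1 : 1 <= W) (abW : forall i, b 0 i - a 0 i <= W).
Context (eps sigma gamma p L : R) (eps_ge0 : 0 <= eps) (sigma_ge0 : 0 <= sigma)
  (gamma_ge0 : 0 <= gamma) (p01 : 0 <= p <= 1).
Context (H : 'rV[R]_d -> R -> 'rV[R]_d -> R).
Context (H_lip : forall x, box a b x ->
  L.-lipschitz (fun z : 'rV[R]_d * R => H z.1 z.2 x)).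

Local Notation hh := (mesh_size a b J).

Let hhX i k : h i ^+ k <= hh ^+ k.
Proof.
have h1 := step_gt0 i; have h2 := step_le_mesh_size i.
by apply: lerXn2r; rewrite ?nnegrE//; [exact: ltW|exact: le_trans (ltW h1) h2].
Qed.

Let hhP i : h i `^ p <= hh `^ p.
Proof.
have /andP[p0 _] := p01; have h1 := step_gt0 i; have h2 := step_le_mesh_size i.
by apply: ge0_ler_powR; rewrite ?nnegrE//;
  [exact: ltW|exact: le_trans (ltW h1) h2].
Qed.

Let hW i : h i `^ p <= W.
Proof.
have /andP[p0 p1] := p01; have h1 := step_gt0 i.
have h2 : h i <= W := le_trans (step_le_width i) (abW i).
apply: le_trans (ler1_powR W1 p1).
by apply: ge0_ler_powR; rewrite ?nnegrE//;
  [exact: ltW|exact: le_trans (ltW h1) h2].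
Qed.

Lemma gradient_error alpha : interior_idx a b J alpha ->
  `|H (grad v (x_ alpha)) (v (x_ alpha)) (x_ alpha)
    - H (grad_h h V alpha) (V alpha) (x_ alpha)| <= `|L| * M * hh ^+ 2.
Proof.
move=> aD; have [aJ xD] := aD; rewrite agr//.
have := H_lip _ xD
  (grad v (x_ alpha), v (x_ alpha), (grad_h h V alpha, v (x_ alpha))).
move=> /(_ (conj I I))/= /le_trans; apply; rewrite -mulrA.
apply: le_trans (ler_wpM2r _ (ler_norm L)) _ => //.
rewrite ler_wpM2l// prod_normE/= subrr normr0.
rewrite max_l// [leLHS]mx_normrE.
apply: bigmax_le => [|[z j] _]; first by rewrite mulr_ge0// sqr_ge0.
rewrite !mxE/= distrC; apply: le_trans (delta1_error alpha j aD) _.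
by rewrite ler_wpM2l.
Qed.

Lemma residual_le alpha : interior_idx a b J alpha ->
  `|Hop eps H v (x_ alpha) - Hop_h a b J eps sigma gamma p H V alpha|
    <= (d%:R * (2 * M * sigma + 2 * M * eps + 3 * M * W * gamma) + `|L| * M)
         * hh ^+ 2
       + gamma * K * (hh `^ p * hh ^+ q)
         * \sum_(i < d) (near_bdry J i (alpha 0 i))%:R.
Proof.
move=> aD.
have hh0 k : 0 <= hh ^+ k.
  by apply: exprn_ge0; rewrite /mesh_size; apply: bigmax_ge_id.
have viscosity : `|\sum_(i < d) h i ^+ 2 * delta2 h i V alpha|
    <= d%:R * (2 * M * hh ^+ 2).
  apply: norm_sum_le => i; rewrite normrM ger0_norm ?sqr_ge0// mulrC.
  by apply: ler_pM; rewrite ?sqr_ge0//; exact: delta2_le.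
have lap : `|laplacian_h h V alpha - laplacian v (x_ alpha)|
    <= d%:R * (2 * M * hh ^+ 2).
  rewrite -sumrB; apply: norm_sum_le => i.
  apply: le_trans (delta2_error alpha i aD) _.
  by rewrite ler_wpM2l// mulr_ge0.
have mom : `|moment h p V alpha| <= d%:R * (3 * M * W * hh ^+ 2)
    + K * (hh `^ p * hh ^+ q) * \sum_(i < d) (near_bdry J i (alpha 0 i))%:R.
  apply: le_trans (ler_norm_sum _ _ _) _.
  have -> : d%:R * (3 * M * W * hh ^+ 2) = \sum_(i < d) 3 * M * W * hh ^+ 2.
    by rewrite sumr_const card_ord mulr_natl.
  rewrite mulr_sumr -big_split; apply: ler_sum => i _ /=.
  rewrite normrM ger0_norm ?powR_ge0//.
  apply: le_trans (ler_wpM2l (powR_ge0 _ _) (moment_term_le alpha i aD)) _.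
  rewrite mulrDr lerD//.
    rewrite mulrCA -[leRHS]mulrA.
    apply: ler_wpM2l; first exact: mulr_ge0.
    by apply: ler_pM; rewrite ?powR_ge0 ?sqr_ge0.
  rewrite [leLHS]mulrA ler_wpM2r// mulrCA ler_wpM2l// ler_pM ?powR_ge0//.
  exact/exprn_ge0/ltW/step_gt0.
have grd := gradient_error alpha aD.
rewrite /Hop /Hop_h /=.
move: (laplacian_h _ _ _) (laplacian _ _) lap => lh l lap.
move: (\sum_(i < d) h i ^+ 2 * _) viscosity => s viscosity.
move: (moment _ _ _ _) mom => m mom.
move: (H _ _ _) (H _ _ _) grd => H2 H1 grd.
have -> : - (eps * l) + H1 - (- (sigma * s) - eps * lh + H2 + gamma * m)
  = sigma * s + eps * (lh - l) + (H1 - H2) - gamma * m by ring.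
apply: le_trans (ler_normB _ _) _.
apply: le_trans (lerD (ler_normD _ _) (lexx _)) _.
apply: le_trans (lerD (lerD (ler_normD _ _) (lexx _)) (lexx _)) _.
rewrite !(normrM gamma) !(normrM eps) !(normrM sigma) !(@ger0_norm _ gamma)//
  !(@ger0_norm _ eps)// !(@ger0_norm _ sigma)//.
apply: le_trans (lerD (lerD (lerD (ler_wpM2l sigma_ge0 viscosity)
  (ler_wpM2l eps_ge0 lap)) grd) (ler_wpM2l gamma_ge0 mom)) _.
rewrite le_eqVlt; apply/orP; left; apply/eqP; ring.
Qed.

End GridFunction.
End Grid.
End TruncationError.

Lemma sum_interior_prod {R : realType} {d : nat} (a b : 'rV[R]_d)
    (J : 'I_d -> nat) :
  (forall i, a 0 i < b 0 i) -> (forall i, (3 <= J i)%N) ->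
  exists s : seq 'rV[int]_d,
    [/\ uniq s, interior_idx a b J = [set` s] &
        forall F : 'I_d -> int -> R, \sum_(alpha <- s) \prod_i F i (alpha 0 i)
          = \prod_i \sum_(2 <= k < J i) F i k%:Z].
Proof.
move=> ab J3; pose N := (\max_i J i)%N.
have JN i : (J i <= N)%N by rewrite /N; exact: leq_bigmax.
pose Q i := [pred k : 'I_N | (1 < k < J i)%N].
pose phi (f : {ffun 'I_d -> 'I_N}) : 'rV[int]_d := \row_i (f i : nat)%:Z.
have phi_inj : injective phi.
  move=> f g /rowP fg; apply/ffunP => i; apply/val_inj.
  by have := fg i; rewrite !mxE => -[].
exists [seq phi f | f <- enum (family Q)]; split.
- by rewrite map_inj_uniq ?enum_uniq.
- apply/seteqP; split=> alpha; rewrite /= interior_idxP//; last first.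
    move=> /mapP[f]; rewrite mem_enum => /familyP fQ -> i.
    by have := fQ i; rewrite inE /= mxE; lia.
  move=> aD.
  have aN i : (absz (alpha 0%R i) < N)%N.
    by apply: (leq_trans _ (JN i)); have := aD i; case: (alpha 0 i) => n; lia.
  apply/mapP; exists [ffun i => Ordinal (aN i)].
    rewrite mem_enum; apply/familyP => i; rewrite ffunE inE /=.
    by have := aD i; case: (alpha 0 i) => n; lia.
  apply/rowP => i; rewrite mxE ffunE /=.
  by have := aD i; case: (alpha 0 i) => n; lia.
- move=> F; rewrite big_map big_enum /=.
  transitivity (\prod_i \sum_(k < N | Q i k) F i (k : nat)%:Z).
    rewrite (bigA_distr_big_dep (fun i => Q i)
      (fun i (k : 'I_N) => F i (k : nat)%:Z)).
    by apply: eq_bigr => f _; apply: eq_bigr => i _; rewrite mxE.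
  apply: eq_bigr => i _; rewrite (big_nat_widen _ _ _ _ _ (JN i)) big_geq_mkord.
  by apply: eq_bigl => k; rewrite /= andbC.
Qed.

Lemma near_bdry_count {R : realType} {d : nat} (J : 'I_d -> nat) (i : 'I_d) :
  \sum_(2 <= k < J i) (near_bdry J i k%:Z)%:R <= 2 :> R.
Proof.
have count1 m : (\sum_(2 <= k < J i) (k == m) <= 1)%N.
  under eq_bigr => k _ do rewrite -[nat_of_bool _]/(if k == m then 1 else 0)%N.
  rewrite -big_mkcond sum1_count count_uniq_mem ?iota_uniq//; exact: leq_b1.
rewrite -natr_sum ler_nat.
apply: (leq_trans _ (leq_add (count1 2%N) (count1 (J i).-1))).
rewrite -big_split/= !big_nat; apply: leq_sum => k kJ.
rewrite /near_bdry; have -> : (k%:Z == (J i)%:Z - 1) = (k == (J i).-1) by lia.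
by rewrite -[k%:Z == 2]/(k == 2%N); do 2 case: eqP.
Qed.

Lemma powR_le_mul {R : realType} (x W r m : R) : 0 < x -> x <= W -> m <= r ->
  x `^ r <= W `^ (r - m) * x `^ m.
Proof.
move=> x0 xW mr; rewrite -[X in x `^ X](subrK m).
rewrite (@powRD _ x) ?(gt_eqF x0) ?implybT//.
apply: ler_wpM2r; first exact: powR_ge0.
apply: ge0_ler_powR; rewrite ?nnegrE ?subr_ge0 ?(ltW x0)//.
exact: le_trans (ltW x0) xW.
Qed.

Lemma sum_bool_sqr_le {R : realType} {d : nat} (c : 'I_d -> bool) :
  (\sum_(i < d) (c i)%:R) ^+ 2 <= d%:R * \sum_(i < d) (c i)%:R :> R.
Proof.
have s0 : 0 <= \sum_(i < d) (c i)%:R :> R by apply: sumr_ge0.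
rewrite expr2 ler_wpM2r//.
rewrite -[d in leRHS]card_ord -sum1_card natr_sum.
by apply: ler_sum => i _; rewrite ler_nat leq_b1.
Qed.

Lemma sqr_add_le {R : realType} (x y : R) :
  (x + y) ^+ 2 <= 2 * x ^+ 2 + 2 * y ^+ 2.
Proof. by have := sqr_ge0 (x - y); nra. Qed.

Lemma truncation_error_le {R : realType} {d : nat} (a b : 'rV[R]_d)
    (eps sigma gamma p : R) (H : 'rV[R]_d -> R -> 'rV[R]_d -> R)
    (v : 'rV[R]_d -> R) (J : 'I_d -> nat) (V : 'rV[int]_d -> R) (A B W : R) :
  (forall i, a 0 i < b 0 i) -> (forall i, (3 <= J i)%N) ->
  1 <= W -> (forall i, b 0 i - a 0 i <= W) -> 0 <= A -> 0 <= B ->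
  (forall alpha, interior_idx a b J alpha ->
    `|Hop eps H v (node a b J alpha) - Hop_h a b J eps sigma gamma p H V alpha|
      <= A + B * \sum_(i < d) (near_bdry J i (alpha 0 i))%:R) ->
  truncation_error a b J eps sigma gamma p H v V ^+ 2
    <= W ^+ d * (2 * A ^+ 2 + 4 * d%:R ^+ 2 * B ^+ 2 * mesh_size a b J).
Proof.
move=> ab J3 W1 abW A0 B0 err.
have [s [us Is sF]] := sum_interior_prod a b J ab J3.
pose h := step a b J; pose hh := mesh_size a b J.
have h0 i : 0 < h i by exact: step_gt0.
have hJ i : h i * (J i - 2)%:R <= W.
  apply: le_trans (abW i).
  rewrite -(step_mul a b J J3 i) ler_wpM2l ?(ltW (h0 i))//.
  by rewrite natrB 1?ltnW// lerD2l lerN2 ler1n.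
have hhh i : h i <= hh by exact: step_le_mesh_size.
rewrite /truncation_error exprMn sqr_sqrtr; last first.
  by rewrite Is -fsbig_seq//; apply: sumr_ge0 => alpha _; exact: sqr_ge0.
rewrite -prodrXl (eq_bigr h); last first.
  by move=> i _; rewrite sqr_sqrtr ?(ltW (h0 i)).
rewrite Is -fsbig_seq//.
have weight (F : 'I_d -> int -> R) :
    (\prod_i h i) * \sum_(alpha <- s) \prod_i F i (alpha 0 i)
    = \prod_i (h i * \sum_(2 <= k < J i) F i k%:Z).
  by rewrite sF -big_split.
have count_all : (\prod_i h i) * \sum_(alpha <- s) 1 <= W ^+ d.
  have -> : \sum_(alpha <- s) 1 = \sum_(alpha <- s) \prod_(i < d) (1 : R).
    by apply: eq_bigr => alpha _; rewrite big1.
  rewrite (weight (fun _ _ => 1)) -[d in _ ^+ d]card_ord -prodr_const.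
  apply: ler_prod => i _; rewrite sumr_const_nat hJ andbT.
  by rewrite mulr_ge0 ?(ltW (h0 i)).
have count_near i :
    (\prod_i h i) * \sum_(alpha <- s) (near_bdry J i (alpha 0 i))%:R
    <= 2 * hh * W ^+ d.
  pose F (j : 'I_d) (k : int) : R := if j == i then (near_bdry J i k)%:R else 1.
  have -> : \sum_(alpha <- s) (near_bdry J i (alpha 0 i))%:R
      = \sum_(alpha <- s) \prod_j F j (alpha 0 j).
    apply: eq_bigr => alpha _; rewrite (bigD1 i)//= /F eqxx big1 ?mulr1//.
    by move=> j /negbTE ->.
  rewrite weight (bigD1 i)//= {1}/F eqxx.
  have F0 j (k : int) : 0 <= F j k by rewrite /F; case: ifP.
  apply: ler_pM.
  - by rewrite mulr_ge0 ?(ltW (h0 i))// sumr_ge0.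
  - by apply: prodr_ge0 => j _; rewrite mulr_ge0 ?(ltW (h0 j))// sumr_ge0.
  - rewrite mulrC ler_pM ?sumr_ge0 ?(ltW (h0 i))//.
    exact: near_bdry_count.
  - apply: (@le_trans _ _ (\prod_(j < d | j != i) W)).
      apply: ler_prod => j ji.
      rewrite mulr_ge0 ?(ltW (h0 j)) ?sumr_ge0//=.
      rewrite (eq_bigr (fun=> 1)); last by move=> k _; rewrite /F (negbTE ji).
      by rewrite sumr_const_nat.
    rewrite prodr_const ler_weXn2l//.
    by rewrite -[leqRHS]card_ord max_card.
have P0 : 0 <= \prod_i h i by apply: prodr_ge0 => i _; exact: ltW.
pose near (alpha : 'rV[int]_d) :=
  \sum_(i < d) (near_bdry J i (alpha 0 i))%:R : R.
apply: (@le_trans _ _ ((\prod_i h i) * \sum_(alpha <- s)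
    (2 * A ^+ 2 * 1 + 2 * d%:R * B ^+ 2 * near alpha))).
  apply: ler_wpM2l => //; rewrite !big_seq; apply: ler_sum => alpha sa.
  have aD : interior_idx a b J alpha by rewrite Is.
  have n0 : 0 <= near alpha by exact: sumr_ge0.
  apply: (@le_trans _ _ ((A + B * near alpha) ^+ 2)).
    apply: lerXn2r; rewrite ?nnegrE ?normr_ge0 ?addr_ge0 ?mulr_ge0//.
    exact: err.
  apply: le_trans (sqr_add_le _ _) _; rewrite mulr1 lerD2l exprMn.
  rewrite [leRHS](_ : _ = 2 * (B ^+ 2 * (d%:R * near alpha))); last by ring.
  apply: ler_wpM2l => //; apply: ler_wpM2l; first exact: sqr_ge0.
  exact: sum_bool_sqr_le.
have -> : \sum_(alpha <- s) (2 * A ^+ 2 * 1 + 2 * d%:R * B ^+ 2 * near alpha)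
    = 2 * A ^+ 2 * (\sum_(alpha <- s) 1) + 2 * d%:R * B ^+ 2
      * (\sum_i \sum_(alpha <- s) (near_bdry J i (alpha 0 i))%:R).
  rewrite big_split/= -!big_distrr/=.
  by congr (_ + _ * _); exact: exchange_big.
rewrite mulrDr [X in X + _]mulrCA [X in _ + X]mulrCA.
have := count_all.
have : (\prod_i h i)
      * (\sum_i \sum_(alpha <- s) (near_bdry J i (alpha 0 i))%:R)
    <= d%:R * (2 * hh * W ^+ d).
  rewrite mulr_sumr; apply: le_trans (ler_sum _ (fun i _ => count_near i)) _.
  by rewrite sumr_const card_ord [leRHS]mulr_natl.
move=> c2 c1.
have A2 : 0 <= 2 * A ^+ 2 by rewrite mulr_ge0 ?sqr_ge0.
have B2 : 0 <= 2 * d%:R * B ^+ 2 by rewrite mulr_ge0 ?sqr_ge0 ?mulr_ge0.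
apply: le_trans (lerD (ler_wpM2l A2 c1) (ler_wpM2l B2 c2)) _.
rewrite le_eqVlt; apply/orP; left; apply/eqP; rewrite /hh; ring.
Qed.

Lemma truncation_error_order {R : realType} {d : nat} (a b : 'rV[R]_d)
    (eps sigma gamma p K M W : R) (q : nat) (H : 'rV[R]_d -> R -> 'rV[R]_d -> R)
    (v : 'rV[R]_d -> R) :
  (0 < d)%N -> (forall i, a 0 i < b 0 i) ->
  0 <= eps -> 0 <= sigma -> 0 <= gamma -> 0 <= p <= 1 ->
  lipschitz12 (box a b) H -> Ck_closure 5 (box a b) v ->
  0 <= M ->
  (forall i j x, (j <= 5)%N -> box a b x -> `|pderiv (nseq j i) v x| <= M) ->
  1 <= W -> (forall i, b 0 i - a 0 i <= W) -> 0 <= K ->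
  exists C, forall J V, (forall i, (3 <= J i)%N) -> agrees_on_grid a b J v V ->
    (forall alpha alpha' i, interior_idx a b J alpha ->
      alpha' = alpha + eidx i \/ alpha' = alpha - eidx i ->
      `|delta2 (step a b J) i V alpha' - delta2 (step a b J) i V alpha|
        <= K * step a b J i ^+ q) ->
    truncation_error a b J eps sigma gamma p H v V
      <= C * mesh_size a b J `^ Num.min 2 (p + q%:R + 1 / 2).
Proof.
move=> d0 ab eps0 sigma0 gamma0 p01 [L H_lip] v5 M0 Mv W1 abW K0.
pose m := Num.min 2 (p + q%:R + 1 / 2).
pose A := d%:R * (2 * M * sigma + 2 * M * eps + 3 * M * W * gamma) + `|L| * M.
pose c1 := W `^ (2 - m); pose c2 := W `^ (p + q%:R + 1 / 2 - m).
pose D := W ^+ d * (2 * (A * c1) ^+ 2 + 4 * d%:R ^+ 2 * (gamma * K * c2) ^+ 2).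
have W0 : 0 <= W by exact: le_trans W1.
have A0 : 0 <= A by rewrite /A !(addr_ge0, mulr_ge0).
have D0 : 0 <= D.
  apply: mulr_ge0; first exact: exprn_ge0.
  by apply: addr_ge0; apply: mulr_ge0; rewrite ?sqr_ge0// mulr_ge0 ?sqr_ge0.
exists (Num.sqrt D) => J V J3 agr incr; rewrite -/m.
set hh := mesh_size a b J.
have hh0 : 0 < hh.
  apply: lt_le_trans (step_le_mesh_size a b J (Ordinal d0)).
  exact: step_gt0 a b ab J J3 _.
have hhW : hh <= W.
  apply: bigmax_le => // i _.
  exact: le_trans (step_le_width a b ab J J3 i) (abW i).
have E0 : 0 <= truncation_error a b J eps sigma gamma p H v V.
  by rewrite mulr_ge0 ?sqrtr_ge0// prodr_ge0// => i _; exact: sqrtr_ge0.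
rewrite -(@ler_pXn2r _ 2) ?nnegrE//; last first.
  by rewrite mulr_ge0 ?sqrtr_ge0 ?powR_ge0.
have B0 : 0 <= gamma * K * (hh `^ p * hh ^+ q).
  by rewrite !mulr_ge0 ?powR_ge0 ?exprn_ge0// ltW.
have A20 : 0 <= A * hh ^+ 2 by rewrite mulr_ge0 ?sqr_ge0.
have := @truncation_error_le R d a b eps sigma gamma p H v J V _ _ W
  ab J3 W1 abW A20 B0.
move=> /(_ _)/le_trans; apply.
  move=> alpha; exact: residual_le.
have m2 : m <= 2 by rewrite /m ge_min lexx.
have mq : m <= p + q%:R + 1 / 2 by rewrite /m ge_min lexx orbT.
have h1 : hh ^+ 2 <= c1 * hh `^ m.
  by rewrite -powR_mulrn ?(ltW hh0)//; exact: powR_le_mul.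
have h2 : hh `^ (p + q%:R + 1 / 2) <= c2 * hh `^ m by exact: powR_le_mul.
have hq : (hh `^ p * hh ^+ q) ^+ 2 * hh = (hh `^ (p + q%:R + 1 / 2)) ^+ 2.
  rewrite !(@powRD _ hh) ?(gt_eqF hh0) ?implybT//.
  rewrite div1r powR12_sqrt ?(ltW hh0)//.
  by rewrite [RHS]exprMn sqr_sqrtr ?(ltW hh0)// powR_mulrn ?(ltW hh0).
have e1 : (A * hh ^+ 2) ^+ 2 <= (A * c1) ^+ 2 * (hh `^ m) ^+ 2.
  rewrite -exprMn; apply: lerXn2r; rewrite ?nnegrE//.
    by rewrite !mulr_ge0 ?powR_ge0.
  by rewrite -mulrA; apply: ler_wpM2l.
have e2 : (gamma * K * (hh `^ p * hh ^+ q)) ^+ 2 * hh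
    <= (gamma * K * c2) ^+ 2 * (hh `^ m) ^+ 2.
  rewrite [in leLHS]exprMn -[leLHS]mulrA hq -!exprMn.
  apply: lerXn2r; rewrite ?nnegrE.
  - by rewrite !mulr_ge0 ?powR_ge0.
  - by rewrite !mulr_ge0 ?powR_ge0.
  - by rewrite -[leRHS]mulrA; apply: ler_wpM2l => //; exact: mulr_ge0.
rewrite [leRHS]exprMn sqr_sqrtr// /D -[leRHS]mulrA.
apply: ler_wpM2l; first exact: exprn_ge0.
rewrite [leRHS]mulrDl; apply: lerD; first by rewrite -mulrA; apply: ler_wpM2l.
rewrite -[leLHS]mulrA -[leRHS]mulrA; apply: ler_wpM2l => //.
Qed.

Theorem theorem4p3 (R : realType) (d : nat) (d_gt0 : (0 < d)%N)
  (a b : 'rV[R]_d) (ab : forall i, a 0 i < b 0 i)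
  (eps sigma gamma p : R)
  (eps_ge0 : 0 <= eps) (sigma_ge0 : 0 <= sigma) (gamma_ge0 : 0 <= gamma)
  (p01 : 0 <= p <= 1)
  (H : 'rV[R]_d -> R -> 'rV[R]_d -> R)
  (H_lip : lipschitz12 (box a b) H)
  (H_mono : nondecreasing2 (box a b) H)
  (v : 'rV[R]_d -> R) (v_C5 : Ck_closure 5 (box a b) v) :
  (exists C : R, forall (J : 'I_d -> nat) (V : 'rV[int]_d -> R),
     (forall i, (3 <= J i)%N) ->
     agrees_on_grid a b J v V -> BC1 a b J V ->
     truncation_error a b J eps sigma gamma p H v V
       <= C * mesh_size a b J `^ (p + 1 / 2)) /\
  (exists C : R, forall (J : 'I_d -> nat) (V : 'rV[int]_d -> R),
     (forall i, (3 <= J i)%N) ->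
     agrees_on_grid a b J v V -> BC2 a b J V ->
     truncation_error a b J eps sigma gamma p H v V
       <= C * mesh_size a b J `^ (Num.min 2 (p + 3 / 2))).
Proof.
have [M [M0 Mv]] := pure_pderiv_bounded a b 5 v ab v_C5.
pose W := 1 + \sum_i (b 0 i - a 0 i).
have width0 i : 0 <= b 0 i - a 0 i by rewrite subr_ge0 ltW.
have W1 : 1 <= W by rewrite lerDl sumr_ge0.
have abW i : b 0 i - a 0 i <= W.
  by rewrite /W (bigD1 i)//= addrCA lerDl addr_ge0// sumr_ge0.
have main K q (K0 : 0 <= K) :=
  @truncation_error_order R d a b eps sigma gamma p K M W q H v
    d_gt0 ab eps_ge0 sigma_ge0 gamma_ge0 p01 H_lip v_C5 M0 Mv W1 abW K0.
have K1 : 0 <= 4 * M by rewrite mulr_ge0.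
have K2 : 0 <= M + 4 * M * W by rewrite addr_ge0// mulr_ge0// (le_trans ler01).
split.
- have [C hC] := main _ 0%N K1; exists C => J V J3 agr bc1.
  have := hC J V J3 agr.
  have -> : Num.min 2 (p + 0%:R + 1 / 2) = p + 1 / 2.
    by move: p01 => /andP[? ?]; rewrite addr0 min_r//; lra.
  apply=> alpha alpha' i aD aa'; rewrite expr0 mulr1.
  have D2 := delta2_le a b ab v v_C5 M Mv J J3 V agr.
  have [a'D|a'D] := pselect (interior_idx a b J alpha').
    apply: le_trans (ler_normB _ _) _.
    by apply: le_trans (lerD (D2 _ i a'D) (D2 _ i aD)) _; lra.
  rewrite (bc1 i alpha' (neighbor_bdry_nodes a b ab J J3 _ _ _ aD aa' a'D)).
  by rewrite sub0r normrN; apply: le_trans (D2 _ i aD) _; lra.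
- have [C hC] := main _ 1%N K2; exists C => J V J3 agr bc2.
  have := hC J V J3 agr.
  have -> : p + 1%:R + 1 / 2 = p + 3 / 2 by lra.
  apply=> alpha alpha' i aD aa'.
  have hi0 := step_gt0 a b ab J J3 i.
  have hiW := le_trans (step_le_width a b ab J J3 i) (abW i).
  have D2 beta :
      interior_idx a b J beta -> interior_idx a b J (beta + eidx i) ->
      `|delta2 (step a b J) i V (beta + eidx i) - delta2 (step a b J) i V beta|
        <= (M + 4 * M * W) * step a b J i ^+ 1.
    move=> bD bpD.
    apply: le_trans
      (delta2_increment a b ab v v_C5 M Mv J J3 V agr _ i bD bpD) _.
    rewrite expr1 [leRHS]mulrDl lerD2l expr2 mulrA.
    apply: ler_wpM2r; first exact: ltW.
    by apply: ler_wpM2l => //; exact: mulr_ge0.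
  have [a'D|a'D] := pselect (interior_idx a b J alpha').
    case: aa' a'D => -> a'D; first exact: D2.
    by rewrite distrC; have := D2 (alpha - eidx i); rewrite subrK; exact.
  have a'S := neighbor_bdry_nodes a b ab J J3 _ _ _ aD aa' a'D.
  rewrite (bc2 i alpha' alpha a'S _ aD).
    by rewrite subrr normr0; apply: mulr_ge0; last exact/exprn_ge0/ltW.
  by case: aa' => ->; [left; rewrite addrK|right; rewrite subrK].
Qed.
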